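(* Let $\mathcal{A}$ be a finite set, let $k,n,d$ be positive integers, and let $\mathcal{D}=((x_i,y_i,a_i))_{i=1}^n$ with $(x_i,y_i,a_i)\in\mathbb{R}^d\times[k]\times\mathcal{A}$. Let $$\mathcal{D}'=\{(x',y',a')=(x_i-x_j,\ \operatorname{sgn}(y_i-y_j),\ (a_i,a_j)) : i,j\in[n],\ y_i\neq y_j\}\subseteq\mathbb{R}^d\times\{-1,1\}\times\mathcal{A}^2,$$ regarded as a family indexed by the ordered pairs $(i,j)$ with $y_i\neq y_j$. For $w\in\mathbb{R}^d$ let $c_w(x)=\operatorname{sgn}(w\cdot x)$ and let $s_w(x)=w\cdot x$. Then for every $w\in\mathbb{R}^d$ and every $\varepsilon\in\mathbb{R}$ the following two equivalences hold. (DP) We have $$\max_{\tilde a,\hat a\in\mathcal{A}}\Big|\mathbb{P}_{(x',y',a')\sim\mathcal{D}'}[c_w(x')=1\mid a'=(\tilde a,\hat a)]-\mathbb{P}_{(x',y',a')\sim\mathcal{D}'}[c_w(x')=1\mid a'=(\hat a,\tilde a)]\Big|\le\varepsilon$$ if and only if $s_w$ satisfies $\text{DP-viol}(s_w;\mathcal{D})\le\varepsilon$ conditioned on $y_1\neq y_2$, i.e. $$\max_{\tilde a,\hat a\in\mathcal{A}}\Big|\mathbb{P}[s_w(x_1)>s_w(x_2)\mid a_1=\tilde a,a_2=\hat a,y_1\neq y_2]-\mathbb{P}[s_w(x_1)<s_w(x_2)\mid a_1=\tilde a,a_2=\hat a,y_1\neq y_2]\Big|\le\varepsilon .$$ (EO)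 We have $$\max_{\tilde a,\hat a\in\mathcal{A}}\Big|\mathbb{P}_{(x',y',a')\sim\mathcal{D}'}[c_w(x')=1\mid a'=(\tilde a,\hat a),y'=1]-\mathbb{P}_{(x',y',a')\sim\mathcal{D}'}[c_w(x')=1\mid a'=(\hat a,\tilde a),y'=1]\Big|\le\varepsilon$$ if and only if $\text{EO-viol}(s_w;\mathcal{D})\le\varepsilon$, i.e. $$\max_{\tilde a,\hat a\in\mathcal{A}}\Big|\mathbb{P}[s_w(x_1)>s_w(x_2)\mid a_1=\tilde a,a_2=\hat a,y_1>y_2]-\mathbb{P}[s_w(x_1)<s_w(x_2)\mid a_1=\tilde a,a_2=\hat a,y_1<y_2]\Big|\le\varepsilon .$$
   Context: $[k]=\{1,\dots,k\}$. $\operatorname{sgn}(t)=1$ if $t>0$, $\operatorname{sgn}(t)=-1$ if $t<0$, and $\operatorname{sgn}(0)\neq 1$ (say $\operatorname{sgn}(0)=0$). $\mathbb{P}_{(x',y',a')\sim\mathcal{D}'}$ denotes the uniform distribution over the indexed family $\mathcal{D}'$ (repeated elements counted with multiplicity). In the probabilities involving $s_w$, $(x_1,y_1,a_1)$ and $(x_2,y_2,a_2)$ are two independent samples drawn uniformly (with replacement) from the entries of $\mathcal{D}$. The maxima range over those pairs $(\tilde a,\hat a)$ for which all events conditioned on have positive probability. *)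

(* Defs.v *)
From mathcomp Require Import all_boot all_order all_algebra.
From mathcomp Require Import constructive_ereal reals.

Set Implicit Arguments.
Unset Strict Implicit.
Unset Printing Implicit Defensive.

Import Order.TTheory GRing.Theory Num.Theory.
Local Open Scope ring_scope.

Definition prob (R : realType) (T : finType) (mu : T -> R) (E : pred T) : R :=
  \sum_(t | E t) mu t.

(* Equal to 0 when C has probability 0; only used under 0 < prob mu C. *)
Definition cond_prob (R : realType) (T : finType) (mu : T -> R)
    (E C : pred T) : R :=
  prob mu (predI E C) / prob mu C.

(* The zero weight when T is empty, so that no event has positive
   probability then. *)
Definition uniform_on (R : realType) (T : finType) : T -> R :=
  fun=> #|T|%:R^-1.

(* Joint law of two independent samples of laws mu and nu. *)
Definition indep_pair (R : realType) (S T : finType)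
    (mu : S -> R) (nu : T -> R) : S * T -> R :=
  fun p => mu p.1 * nu p.2.

(* The maximum over an empty set of indices is -oo. *)
Definition max_over (R : realType) (I : finType) (adm : pred I) (F : I -> R) :
    \bar R :=
  \big[Order.max/-oo%E]_(i | adm i) (F i)%:E.

Record example (R : realType) (d : nat) (L B : Type) := Example {
  feature : 'rV[R]_d;
  label : L;
  attribute : B }.

(* The label l in {1, ..., k} is encoded as l - 1 : 'I_k; labels are only
   compared and subtracted from each other. *)
Definition dataset (R : realType) (d k n : nat) (A : finType) :=
  'I_n -> example R d 'I_k A.

Definition dot (R : realType) (d : nat) (u v : 'rV[R]_d) : R :=
  \sum_(j < d) u 0 j * v 0 j.

Definition score (R : realType) (d : nat) (w : 'rV[R]_d) : 'rV[R]_d -> R :=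
  fun x => dot w x.

Definition classifier (R : realType) (d : nat) (w : 'rV[R]_d) :
    'rV[R]_d -> R :=
  fun x => Num.sg (dot w x).

Definition pair_index (R : realType) (d k n : nat) (A : finType)
    (D : dataset R d k n A) : finType :=
  {p : 'I_n * 'I_n | label (D p.1) != label (D p.2)}.

(* The family D' of the differences of the examples of D. *)
Definition pair_data (R : realType) (d k n : nat) (A : finType)
    (D : dataset R d k n A) (t : pair_index D) : example R d int (A * A) :=
  let e1 := D (val t).1 in
  let e2 := D (val t).2 in
  Example (feature e1 - feature e2)
          (Num.sg ((label e1)%:Z - (label e2)%:Z))
          (attribute e1, attribute e2).

Definition DP_viol_pair (R : realType) (d k n : nat) (A : finType)
    (c : 'rV[R]_d -> R) (D : dataset R d k n A) : \bar R :=
  let mu := @uniform_on R (pair_index D) in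
  let pos := [pred t : pair_index D | c (feature (pair_data t)) == 1] in
  let att b := [pred t : pair_index D | attribute (pair_data t) == b] in
  max_over
    (fun p : A * A =>
      (0 < prob mu (att (p.1, p.2))) && (0 < prob mu (att (p.2, p.1))))
    (fun p : A * A =>
      `|cond_prob mu pos (att (p.1, p.2)) - cond_prob mu pos (att (p.2, p.1))|).

Definition EO_viol_pair (R : realType) (d k n : nat) (A : finType)
    (c : 'rV[R]_d -> R) (D : dataset R d k n A) : \bar R :=
  let mu := @uniform_on R (pair_index D) in
  let pos := [pred t : pair_index D | c (feature (pair_data t)) == 1] in
  let att b := [pred t : pair_index D |
    (attribute (pair_data t) == b) && (label (pair_data t) == 1)] in
  max_over
    (fun p : A * A =>
      (0 < prob mu (att (p.1, p.2))) && (0 < prob mu (att (p.2, p.1))))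
    (fun p : A * A =>
      `|cond_prob mu pos (att (p.1, p.2)) - cond_prob mu pos (att (p.2, p.1))|).

Definition two_samples (R : realType) (n : nat) : 'I_n * 'I_n -> R :=
  indep_pair (@uniform_on R 'I_n) (@uniform_on R 'I_n).

(* Conditioned on the two labels being different. *)
Definition DP_viol_neq (R : realType) (d k n : nat) (A : finType)
    (s : 'rV[R]_d -> R) (D : dataset R d k n A) : \bar R :=
  let mu := @two_samples R n in
  let gt := [pred t : 'I_n * 'I_n |
    s (feature (D t.1)) > s (feature (D t.2))] in
  let lt := [pred t : 'I_n * 'I_n |
    s (feature (D t.1)) < s (feature (D t.2))] in
  let cond (p : A * A) := [pred t : 'I_n * 'I_n |
    [&& attribute (D t.1) == p.1, attribute (D t.2) == p.2 &
        label (D t.1) != label (D t.2)]] in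
  max_over
    (fun p : A * A => 0 < prob mu (cond p))
    (fun p : A * A =>
      `|cond_prob mu gt (cond p) - cond_prob mu lt (cond p)|).

Definition EO_viol (R : realType) (d k n : nat) (A : finType)
    (s : 'rV[R]_d -> R) (D : dataset R d k n A) : \bar R :=
  let mu := @two_samples R n in
  let gt := [pred t : 'I_n * 'I_n |
    s (feature (D t.1)) > s (feature (D t.2))] in
  let lt := [pred t : 'I_n * 'I_n |
    s (feature (D t.1)) < s (feature (D t.2))] in
  let cond_gt (p : A * A) := [pred t : 'I_n * 'I_n |
    [&& attribute (D t.1) == p.1, attribute (D t.2) == p.2 &
        (label (D t.2) < label (D t.1))%N]] in
  let cond_lt (p : A * A) := [pred t : 'I_n * 'I_n |
    [&& attribute (D t.1) == p.1, attribute (D t.2) == p.2 &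
        (label (D t.1) < label (D t.2))%N]] in
  max_over
    (fun p : A * A => (0 < prob mu (cond_gt p)) && (0 < prob mu (cond_lt p)))
    (fun p : A * A =>
      `|cond_prob mu gt (cond_gt p) - cond_prob mu lt (cond_lt p)|).

(* Main.v *)
Require Import Defs.
From mathcomp Require Import all_boot all_order all_algebra.
From mathcomp Require Import constructive_ereal reals.

(** Both equivalences come from equalities of the maxima: they agree pair by
    pair.  A conditional probability for a uniform law is a ratio of
    cardinals, so conditioning on an event contained in [y1 != y2] gives the
    same value on the family D' as on two independent samples.  Exchanging
    the two samples turns the event [s(x1) > s(x2)] given [(a^, a~)] into
    [s(x1) < s(x2)] given [(a~, a^)]. *)

Set Implicit Arguments.
Unset Strict Implicit.
Unset Printing Implicit Defensive.

Import Order.TTheory GRing.Theory Num.Theory.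
Local Open Scope ring_scope.

Lemma eq_max_over (R : realType) (I : finType) (P Q : pred I) (F G : I -> R) :
  P =1 Q -> F =1 G -> max_over P F = max_over Q G.
Proof. by move=> PQ FG; apply: eq_big => // i _; rewrite FG. Qed.

Section UniformLaw.
Variables (R : realType) (T : finType).
Implicit Types E C : pred T.

Lemma prob_uniform E : prob (@uniform_on R T) E = #|E|%:R / #|T|%:R.
Proof. by rewrite /prob /uniform_on sumr_const mulr_natl. Qed.

Lemma prob_uniform_gt0 E : (0 < prob (@uniform_on R T) E) = (0 < #|E|)%N.
Proof.
rewrite prob_uniform; have [E0|E_gt0] := posnP #|E|; first by rewrite E0 mul0r ltxx.
by rewrite divr_gt0 ?ltr0n// (leq_trans E_gt0) ?max_card.
Qed.

(* When T is empty both sides are 0, thanks to the convention x / 0 = 0. *)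
Lemma cond_prob_uniform E C :
  cond_prob (@uniform_on R T) E C = #|predI E C|%:R / #|C|%:R.
Proof.
rewrite /cond_prob !prob_uniform; have [T0|T_gt0] := posnP #|T|.
  have C0 : #|C| = 0%N by apply/eqP; rewrite -leqn0 -T0 max_card.
  by rewrite T0 C0 !(invr0, mulr0).
by rewrite -mulf_div divff ?mulr1 // invr_eq0 pnatr_eq0 -lt0n.
Qed.

End UniformLaw.

Section TwoSamples.
Variables (R : realType) (n : nat).
Implicit Types E C : pred ('I_n * 'I_n).

(** Brings two independent samples under the counting formulas for uniform laws. *)
Lemma two_samples_uniform E :
  prob (@two_samples R n) E = prob (@uniform_on R _) E.
Proof.
apply: eq_bigr => t _.
by rewrite /two_samples /indep_pair /uniform_on card_prod natrM invfM.
Qed.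

(** Both samples have the same law, so exchanging the entries of a pair preserves its weight. *)
Lemma prob_two_samples_swap E E' : (forall i j, E (i, j) = E' (j, i)) ->
  prob (@two_samples R n) E = prob (@two_samples R n) E'.
Proof.
move=> EE'; rewrite /prob (reindex_inj (can_inj (@swap_pairK 'I_n 'I_n))) /=.
by apply: eq_big => [[i j]|[i j] _]; [exact: EE' | exact: mulrC].
Qed.

Lemma cond_prob_two_samples_swap E E' C C' :
    (forall i j, E (i, j) = E' (j, i)) -> (forall i j, C (i, j) = C' (j, i)) ->
  cond_prob (@two_samples R n) E C = cond_prob (@two_samples R n) E' C'.
Proof.
move=> EE' CC'; rewrite /cond_prob (prob_two_samples_swap CC').
by congr (_ / _); apply: prob_two_samples_swap => i j /=; rewrite EE' CC'.
Qed.

End TwoSamples.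

(** [val] is injective and [E] lies inside [P], so [val] maps [E'] onto all of [E]. *)
Lemma card_sig_pred (T : finType) (P : pred T) (E' : pred {x | P x})
    (E : pred T) :
  (forall t, E' t = E (val t)) -> (forall x, E x -> P x) -> #|E'| = #|E|.
Proof.
move=> EE' EP; rewrite -(card_image val_inj); apply: eq_card => x.
apply/imageP/idP => [[t + ->]|Ex]; first by rewrite !unfold_in EE'.
by exists (exist _ x (EP x Ex)) => //; rewrite unfold_in EE'.
Qed.

Section PairIndex.
Variables (R : realType) (d k n : nat) (A : finType) (D : dataset R d k n A).
Variables (C' : pred (pair_index D)) (C : pred ('I_n * 'I_n)).
Hypotheses (CC' : forall t, C' t = C (val t))
           (C_neq : forall p, C p -> label (D p.1) != label (D p.2)).

(** The two spaces may differ in size, so the probabilities themselves may differ; positivity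
    depends only on the event being nonempty. *)
Lemma prob_pair_index_gt0 :
  (0 < prob (@uniform_on R (pair_index D)) C') =
  (0 < prob (@two_samples R n) C).
Proof.
by rewrite two_samples_uniform !prob_uniform_gt0 (card_sig_pred CC' C_neq).
Qed.

(** The sizes of the two spaces cancel in the ratio, and [predI E C] inherits distinct labels from
    [C], so both cardinals carry over. *)
Lemma cond_prob_pair_index (E' : pred (pair_index D))
    (E : pred ('I_n * 'I_n)) : (forall t, E' t = E (val t)) ->
  cond_prob (@uniform_on R (pair_index D)) E' C' =
  cond_prob (@two_samples R n) E C.
Proof.
move=> EE'; rewrite [RHS]/cond_prob !two_samples_uniform -[RHS]/(cond_prob _ E C).
rewrite !cond_prob_uniform (card_sig_pred CC' C_neq).
rewrite (@card_sig_pred _ _ _ (predI E C))// => [t|p /andP[_ /C_neq]//].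
by rewrite /= EE' CC'.
Qed.

End PairIndex.

Lemma classifier_sub_eq1 (R : realType) (d : nat) (w x y : 'rV[R]_d) :
  (classifier w (x - y) == 1) = (score w y < score w x).
Proof.
rewrite /classifier sgr_cp0 -[RHS]subr_gt0 /score /dot -sumrB.
by under eq_bigr do rewrite !mxE mulrBr.
Qed.

Lemma DP_viol_pairE (R : realType) (d k n : nat) (A : finType)
    (D : dataset R d k n A) (w : 'rV[R]_d) :
  DP_viol_pair (classifier w) D = DP_viol_neq (score w) D.
Proof.
pose C (a b : A) := [pred t : 'I_n * 'I_n |
  [&& attribute (D t.1) == a, attribute (D t.2) == b &
      label (D t.1) != label (D t.2)]].
have CE a b (t : pair_index D) :
    (attribute (pair_data t) == (a, b)) = C a b (val t).
  (* The conjunct on distinct labels in [C] is the defining property of the index [t]. *)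
  by rewrite /= xpair_eqE (valP t) andbT.
have C_neq a b p : C a b p -> label (D p.1) != label (D p.2).
  by case/and3P.
have C_swap a b i j : C a b (i, j) = C b a (j, i).
  by rewrite /= andbCA [label _ == _]eq_sym.
have pos_gt (t : pair_index D) := classifier_sub_eq1 w
  (feature (D (val t).1)) (feature (D (val t).2)).
apply: eq_max_over => -[a b] /=.
  (* On D' both orders of [(a, b)] must have positive probability, on two samples only one; the
     exchange makes the two requirements coincide. *)
  rewrite !(prob_pair_index_gt0 (CE _ _) (C_neq _ _)).
  by rewrite (prob_two_samples_swap R (C_swap b a)) andbb.
pose gt := [pred t : 'I_n * 'I_n |
  score w (feature (D t.1)) > score w (feature (D t.2))].
rewrite !(cond_prob_pair_index (CE _ _) (C_neq _ _) (E := gt) pos_gt).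
(* The first terms already agree; only the second one needs the exchange. *)
by congr `| _ - _ |; apply: cond_prob_two_samples_swap => // i j; exact: C_swap.
Qed.

Lemma EO_viol_pairE (R : realType) (d k n : nat) (A : finType)
    (D : dataset R d k n A) (w : 'rV[R]_d) :
  EO_viol_pair (classifier w) D = EO_viol (score w) D.
Proof.
pose C (a b : A) := [pred t : 'I_n * 'I_n |
  [&& attribute (D t.1) == a, attribute (D t.2) == b &
      (label (D t.2) < label (D t.1))%N]].
pose C_lt (a b : A) := [pred t : 'I_n * 'I_n |
  [&& attribute (D t.1) == a, attribute (D t.2) == b &
      (label (D t.1) < label (D t.2))%N]].
have CE a b (t : pair_index D) :
    (attribute (pair_data t) == (a, b)) && (label (pair_data t) == 1) =
    C a b (val t).
  by rewrite /= xpair_eqE sgr_cp0 subr_gt0 ltz_nat andbA.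
have C_neq a b p : C a b p -> label (D p.1) != label (D p.2).
  by case/and3P=> _ _; rewrite neq_ltn => ->; rewrite orbT.
have C_swap a b i j : C a b (i, j) = C_lt b a (j, i) by rewrite /= andbCA.
have pos_gt (t : pair_index D) := classifier_sub_eq1 w
  (feature (D (val t).1)) (feature (D (val t).2)).
apply: eq_max_over => -[a b] /=.
  (* Here the exchange turns [C b a] into [C_lt a b], so the two positivity conditions match one by
     one. *)
  rewrite !(prob_pair_index_gt0 (CE _ _) (C_neq _ _)).
  by rewrite (prob_two_samples_swap R (C_swap b a)).
pose gt := [pred t : 'I_n * 'I_n |
  score w (feature (D t.1)) > score w (feature (D t.2))].
rewrite !(cond_prob_pair_index (CE _ _) (C_neq _ _) (E := gt) pos_gt).
by congr `| _ - _ |; apply: cond_prob_two_samples_swap => // i j; exact: C_swap.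
Qed.

Theorem proposition1 (R : realType) (A : finType) (k n d : nat)
    (k_gt0 : (0 < k)%N) (n_gt0 : (0 < n)%N) (d_gt0 : (0 < d)%N)
    (D : dataset R d k n A) (w : 'rV[R]_d) (eps : R) :
  ((DP_viol_pair (classifier w) D <= eps%:E)%E <->
   (DP_viol_neq (score w) D <= eps%:E)%E)
  /\
  ((EO_viol_pair (classifier w) D <= eps%:E)%E <->
   (EO_viol (score w) D <= eps%:E)%E).
Proof. by rewrite DP_viol_pairE EO_viol_pairE. Qed.
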